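(* Let $k$ be a field, $U$ a $4$-dimensional $k$-vector space, $P=\mathrm{Sym}_\bullet U$, $\Phi_3\in D_3U^*$, and $\mathfrak A=P/\operatorname{ann}\Phi_3$. Assume that $\operatorname{ann}\Phi_3$ contains no nonzero linear form and that $x\in U$ is a weak Lefschetz element on $\mathfrak A$. Fix $x^*\in U^*$ with $x^*(x)=1$, put $U_0=\ker x^*$, fix a basis $y,z,w$ of $U_0$, and let $B$ be the matrix of the $k$-linear map $\mathcal B:\frac{U_0\otimes U_0^*}{\mathrm{ev}^*(1)}\to U_0^*$ defined in the context. Then $B$ has rank $0$, $2$, or $3$, and the number of minimal generators of the ideal $\operatorname{ann}\Phi_3$ is $9$, $7$, or $6$.
   Context: $\otimes=\otimes_k$, $U^*=\mathrm{Hom}_k(U,k)$. $P=\mathrm{Sym}_\bullet U$ is the standard graded polynomial ring and $D_\bullet U^*$ is the divided power algebra, with $D_iU^*=\mathrm{Hom}_k(\mathrm{Sym}_iU,k)$. $D_\bullet U^*$ is a $P$-module: for $u\in\mathrm{Sym}_aU$, $\nu\in D_bU^*$, $u\nu=u(\nu)\in D_{b-a}U^*$ is given by $(u\nu)(u')=\nu(uu')$ for $u'\in\mathrm{Sym}_{b-a}U$ (and $u\nu=0$ if $a>b$). $\operatorname{ann}\Phi=\{f\in P: f\Phi=0\}$. An element $\ell\in U$ is a weak Lefschetz element on $\mathfrak A$ if multiplication by $\ell$, $\mathfrak A_i\to\mathfrak A_{i+1}$, has maximal rank for every $i$. Let $p:U\to U^*$ be $p(u)=u(x\Phi_3)$;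 under the hypotheses it is an isomorphism. $U_0=\ker x^*$ and $U_0^*=\{f\in U^*: f(x)=0\}$; $y^*,z^*,w^*$ is the basis of $U_0^*$ dual to $y,z,w$. For $\nu\in U_0^*$ and $a,b\in U_0$, $\nu(a\wedge b)=\nu(a)b-\nu(b)a\in U_0$. $\mathrm{ev}^*(1)=y\otimes y^*+z\otimes z^*+w\otimes w^*\in U_0\otimes U_0^*$, and $\frac{U_0\otimes U_0^*}{\mathrm{ev}^*(1)}$ is the ($8$-dimensional) quotient by the line spanned by it. The map $\mathcal B$ sends the class of $u\otimes\nu$ ($u\in U_0$, $\nu\in U_0^*$) to $$-[y\,p^{-1}((\nu(z\wedge w)u)(\Phi_3))](\Phi_3)+[z\,p^{-1}((\nu(y\wedge w)u)(\Phi_3))](\Phi_3)-[w\,p^{-1}((\nu(y\wedge z)u)(\Phi_3))](\Phi_3)\in U_0^*.$$ *)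

(* Defs.v *)
From HB Require Import structures.
From mathcomp Require Import all_boot all_order all_algebra.
From mathcomp Require Import mpoly ring.

Set Implicit Arguments.
Unset Strict Implicit.
Unset Printing Implicit Defensive.

Import GRing.Theory.
Import passmx.

Local Open Scope ring_scope.

(* The quotient V / W, realised on the complement of W that mathcomp fixes;
   quo_pi is the projection along W (see quo_pi_surj and quo_pi_ker). *)
Section Quotient.
Variables (k : fieldType) (V : vectType k) (W : {vspace V}).

Definition quo : vectType k := subvs_of (W^C)%VS.

Definition quo_pi : 'Hom(V, quo) :=
  (linfun (@vsproj k V (W^C)%VS) \o daddv_pi (W^C)%VS W)%VF.

Definition quo_repr : 'Hom(quo, V) := linfun vsval.

(* The map induced on V / W by f; only meaningful when f vanishes on W. *)
Definition quo_lift (Z : vectType k) (f : 'Hom(V, Z)) : 'Hom(quo, Z) :=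
  (f \o quo_repr)%VF.

Let capCW : (W^C :&: W = 0)%VS.
Proof. by rewrite capvC capv_compl. Qed.

Let split_pi v : daddv_pi (W^C)%VS W v + daddv_pi W (W^C)%VS v = v.
Proof. by apply: daddv_pi_add capCW _; rewrite addvC addv_complf memvf. Qed.

Let val_pi v : vsval (quo_pi v) = daddv_pi (W^C)%VS W v.
Proof. by rewrite comp_lfunE lfunE /= vsprojK ?memv_pi. Qed.

Lemma quo_reprK (q : quo) : quo_pi (quo_repr q) = q.
Proof.
apply/val_inj; rewrite [LHS]val_pi lfunE /= daddv_pi_id ?capCW //; exact: subvsP.
Qed.

Lemma quo_pi_surj : limg quo_pi = fullv.
Proof.
apply/eqP; rewrite eqEsubv subvf; apply/subvP=> q _.
by rewrite -(quo_reprK q) memv_img ?memvf.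
Qed.

Lemma quo_pi_ker : lker quo_pi = W.
Proof.
apply/vspaceP=> v; rewrite memv_ker -(inj_eq val_inj) [val _]val_pi /=.
apply/eqP/idP=> [v0|Wv].
  by rewrite -(split_pi v) v0 add0r memv_pi.
have := split_pi v.
rewrite [daddv_pi W _ v]daddv_pi_id ?capv_compl //.
by rewrite -[X in _ = X]add0r => /addIr.
Qed.

Lemma quo_liftE (Z : vectType k) (f : 'Hom(V, Z)) v :
  (W <= lker f)%VS -> quo_lift f (quo_pi v) = f v.
Proof.
move=> sWf; rewrite comp_lfunE lfunE /= val_pi -[in RHS](split_pi v).
rewrite linearD /= [X in _ + X](_ : _ = 0) ?addr0 //; apply/eqP.
by rewrite -memv_ker (subvP sWf) ?memv_pi.
Qed.

End Quotient.

(* V (x) W in the coordinates given by vbasis; tens_lift is the universal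
   property. *)
Section Tensor.
Variables (k : fieldType) (V W : vectType k).

Definition tensor : vectType k := 'M[k]_(\dim {:V}, \dim {:W}).

Definition tens (v : V) (w : W) : tensor :=
  (rVof (vbasis {:V}) v)^T *m rVof (vbasis {:W}) w.

Definition tens_lift (Z : vectType k) (f : V -> W -> Z) : 'Hom(tensor, Z) :=
  linfun (fun M : tensor =>
    \sum_i \sum_j M i j *: f (vbasis {:V})`_i (vbasis {:W})`_j).

Lemma tens_liftE (Z : vectType k) (f : V -> W -> Z) v w :
  (forall w, linear (f^~ w)) -> (forall v, linear (f v)) ->
  tens_lift f (tens v w) = f v w.
Proof.
move=> f1 f2; rewrite /tens_lift.
set g := fun M : tensor => _.
have g_lin : linear g.
  move=> a M N; rewrite /g scaler_sumr -big_split; apply: eq_bigr => i _ /=.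
  rewrite scaler_sumr -big_split; apply: eq_bigr => j _ /=.
  by rewrite !mxE scalerDl scalerA.
pose gM := GRing.isLinear.Build _ _ _ _ g g_lin.
pose gL : {linear _ -> _} := HB.pack g gM.
rewrite (lfunE gL) /= /g.
have vE : v = \sum_i coord (vbasis {:V}) i v *: (vbasis {:V})`_i.
  exact: coord_vbasis (memvf _).
have wE : w = \sum_i coord (vbasis {:W}) i w *: (vbasis {:W})`_i.
  exact: coord_vbasis (memvf _).
pose f1L w : {linear V -> Z} :=
  HB.pack (f^~ w) (GRing.isLinear.Build _ _ _ _ (f^~ w) (f1 w)).
pose f2L v : {linear W -> Z} :=
  HB.pack (f v) (GRing.isLinear.Build _ _ _ _ (f v) (f2 v)).
rewrite [in RHS]vE -[RHS]/(f1L w _) linear_sum; apply: eq_bigr => i _.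
rewrite linearZ /= [in RHS]wE -[f _ _]/(f2L _ _) linear_sum scaler_sumr.
apply: eq_bigr => j _; rewrite linearZ /= scalerA; congr (_ *: _).
by rewrite /tens mxE big_ord1 !mxE.
Qed.

End Tensor.

(* The basis e of U identifies Sym U with the polynomial ring in 4 variables,
   e_i corresponding to the variable 'X_i. *)
Section Macaulay.
Variables (k : fieldType) (U : vectType k) (e : 4.-tuple U).

Notation Sym := {mpoly k[4]}.
Notation Symd := (dhomog 4 k).

(* homogeneous component *)
Definition hcomp (d : nat) (f : Sym) : Symd d := DHomog (pihomogP mdeg d f).

Fact hcomp_linear d : linear (hcomp d).
Proof. by move=> a f g; apply/val_inj; rewrite /= linearP. Qed.
HB.instance Definition _ d :=
  GRing.isLinear.Build k Sym (Symd d) _ (hcomp d) (@hcomp_linear d).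

Lemma hcompK d (f : Sym) : f \is d.-homog -> val (hcomp d f) = f.
Proof. exact: pihomog_dE. Qed.

Lemma hcomp_neq0 c d (f : Sym) : c != d -> f \is c.-homog -> hcomp d f = 0.
Proof. by move=> ad fa; apply/val_inj; rewrite /= (pihomog_ne0 ad). Qed.

Definition lform (u : U) : Symd 1 :=
  hcomp 1 (\sum_i coord e i u *: 'X_i : Sym).

Fact lform_linear : linear lform.
Proof.
move=> a u v; rewrite /lform -linearP; congr (hcomp _ _).
rewrite scaler_sumr -big_split; apply: eq_bigr => i _ /=.
by rewrite linearP scalerDl scalerA.
Qed.
HB.instance Definition _ := GRing.isLinear.Build k U (Symd 1) _ lform lform_linear.

Fact val_lformP a u v :
  val (lform (a *: u + v)) = a *: val (lform u) + val (lform v).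
Proof. by rewrite linearP. Qed.

Lemma lformE u : val (lform u) = \sum_i coord e i u *: 'X_i.
Proof.
apply: hcompK; apply: rpred_sum => i _; apply: rpredZ.
by rewrite dhomogX /= mdeg1.
Qed.

Definition hmul (a b : nat) (f : Symd a) (g : Symd b) : Symd (a + b) :=
  hcomp (a + b) (val f * val g).

Lemma hmulE a b (f : Symd a) (g : Symd b) : val (hmul f g) = val f * val g.
Proof. by apply: hcompK; apply: dhomogM; apply: dhomog_is_dhomog. Qed.

Fact hmul_linear a b (f : Symd a) : linear (@hmul a b f).
Proof.
by move=> c g h; apply/val_inj; rewrite /= mulrDr -scalerAr linearP.
Qed.
HB.instance Definition _ a b (f : Symd a) :=
  GRing.isLinear.Build k (Symd b) (Symd (a + b)) _ (hmul f)
    (@hmul_linear a b f).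

(* D_b U^* *)
Definition divpow (b : nat) := 'Hom(Symd b, k^o).

(* The action Sym_a U x D_b U^* -> D_(b-a) U^*.  When a <= b, hcomp b does
   nothing; when b < a, the product has degree a with b - a = 0, so hcomp b
   kills it and the result is 0, as it should be. *)
Definition dact (a b : nat) (f : Symd a) (nu : divpow b) : divpow (b - a) :=
  linfun (fun g : Symd (b - a) => nu (hcomp b (val f * val g))).

Lemma dactE a b (f : Symd a) (nu : divpow b) g :
  dact f nu g = nu (hcomp b (val f * val g)).
Proof.
rewrite /dact; set h := fun g : Symd (b - a) => _.
have h_lin : linear (h : _ -> k^o).
  by move=> c g1 g2; rewrite /h /= mulrDr -scalerAr !linearP.
pose hL : {linear _ -> _} := HB.pack h (GRing.isLinear.Build _ _ _ _ h h_lin).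
by rewrite (lfunE hL).
Qed.

Fact dact_linear a b (nu : divpow b) : linear (fun f : Symd a => dact f nu).
Proof.
move=> c f g; apply/lfunP => h.
by rewrite !lfunE /= lfunE /= !dactE /= mulrDl -scalerAl !linearP.
Qed.

(* The components f_a Phi lie in different degrees of D_. U^*, apart from those
   with a > b, which are 0; so f Phi = 0 iff every f_a Phi is 0. *)
Definition ann (b : nat) (Phi : divpow b) (f : Sym) : Prop :=
  forall a, dact (hcomp a f) Phi = 0.

Definition annd (b : nat) (Phi : divpow b) (i : nat) : {vspace Symd i} :=
  lker (linfun (fun f : Symd i => dact f Phi)).

Lemma mem_annd b (Phi : divpow b) i (f : Symd i) :
  (f \in annd Phi i) = (dact f Phi == 0).
Proof.
rewrite memv_ker; set h := fun f : Symd i => _.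
pose hL : {linear _ -> _} :=
  HB.pack h (GRing.isLinear.Build _ _ _ _ h (@dact_linear i b Phi)).
by rewrite (lfunE hL).
Qed.

Lemma anndP b (Phi : divpow b) i (f : Symd i) :
  f \in annd Phi i <-> ann Phi (val f).
Proof.
rewrite mem_annd; split=> [/eqP f0 a|/(_ i)].
  have [<-|ia] := eqVneq i a.
    suff ->: hcomp i (val f) = f by [].
    by apply/val_inj/hcompK/dhomog_is_dhomog.
  rewrite (hcomp_neq0 ia) ?dhomog_is_dhomog //; apply/lfunP=> g.
  by rewrite dactE mul0r !linear0 lfunE.
suff ->: hcomp i (val f) = f by move->.
by apply/val_inj/hcompK/dhomog_is_dhomog.
Qed.

Definition lmul (l : U) (i : nat) (f : Symd i) : Symd i.+1 := hmul (lform l) f.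

HB.instance Definition _ l i :=
  GRing.isLinear.Build k (Symd i) (Symd i.+1) _ (@lmul l i)
    (hmul_linear (lform l)).

(* the component of degree i of P / ann Phi *)
Definition Aalg (b : nat) (Phi : divpow b) (i : nat) : vectType k :=
  quo (annd Phi i).

Definition Amul (b : nat) (Phi : divpow b) (l : U) (i : nat) :
    'Hom(Aalg Phi i, Aalg Phi i.+1) :=
  quo_lift (annd Phi i) (quo_pi (annd Phi i.+1) \o
                         linfun (@lmul l i))%VF.

Lemma AmulE b (Phi : divpow b) l i (f : Symd i) :
  Amul Phi l i (quo_pi (annd Phi i) f) =
  quo_pi (annd Phi i.+1) (lmul l f).
Proof.
rewrite /Amul quo_liftE.
  by rewrite comp_lfunE (lfunE (@lmul l i)).
apply/subvP=> g; rewrite mem_annd => /eqP g0.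
rewrite memv_ker comp_lfunE (lfunE (@lmul l i)) -memv_ker quo_pi_ker.
rewrite mem_annd; apply/eqP/lfunP=> h; rewrite dactE lfunE /=.
rewrite -[pihomog _ _ _]/(val (hmul (lform l) g)) hmulE mulrAC mulrC.
have [ib|bi] := leqP i.+1 b; last first.
  rewrite (hcomp_neq0 (c := (i + (1 + (b - i.+1)))%N)) ?linear0 //.
    by rewrite neq_ltn (leq_trans bi) ?orbT // addnA addn1 leq_addr.
  by do 2 (apply: dhomogM; first exact: dhomog_is_dhomog); exact: dhomog_is_dhomog.
have e1 : (1 + (b - i.+1) = b - i)%N by rewrite add1n subnSK.
have hom1 : val (lform l) * val h \is (b - i)%N.-homog.
  by rewrite -e1; apply: dhomogM; apply: dhomog_is_dhomog.
move/lfunP/(_ (hcomp (b - i) (val (lform l) * val h))): g0.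
by rewrite dactE hcompK // lfunE.
Qed.

Definition weak_lefschetz (b : nat) (Phi : divpow b) (l : U) : Prop :=
  forall i, \dim (limg (Amul Phi l i)) =
            minn (\dim {:Aalg Phi i}) (\dim {:Aalg Phi i.+1}).

Definition dual : vectType k := 'Hom(U, k^o).

Lemma dualP (a : k) (f g : dual) (t : U) : (a *: f + g) t = a * f t + g t.
Proof. by rewrite lfunE /= lfunE. Qed.

(* D_1 U^* = U^* *)
Definition divpow1 (nu : divpow 1) : dual := (nu \o linfun lform)%VF.

Variable Phi : divpow 3.

(* (u v)(Phi), an element of U^* *)
Definition quad (u v : U) : dual :=
  divpow1 (dact (hmul (lform u) (lform v)) Phi).

Lemma quadE u v t :
  quad u v t = Phi (hcomp 3 (val (lform u) * val (lform v) * val (lform t))).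
Proof.
rewrite comp_lfunE lfunE /=.
by apply: etrans (dactE (hmul (lform u) (lform v)) Phi (lform t)) _; rewrite hmulE.
Qed.

Definition pPhi (x : U) : 'Hom(U, dual) :=
  linfun (fun u : U => divpow1 (dact (lform u) (dact (lform x) Phi))).

Lemma pPhiE x u : pPhi x u = quad x u.
Proof.
have E v t : divpow1 (dact (lform v) (dact (lform x) Phi)) t = quad x v t.
  rewrite quadE comp_lfunE lfunE.
  apply: etrans (dactE (lform v) (dact (lform x) Phi) (lform t)) _.
  apply: etrans (dactE (lform x) Phi (hmul (lform v) (lform t))) _.
  by rewrite (hmulE (lform v) (lform t)) mulrA.
rewrite /pPhi; set h := fun v : U => _.
have h_lin : linear h.
  move=> a v1 v2; apply/lfunP=> t.
  apply: etrans (esym (dualP a (h v1) (h v2) t)).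
  rewrite /h (E v1) (E v2) (E (a *: v1 + v2)).
  rewrite [LHS]quadE [X in _ = a * X + _]quadE [X in _ = _ + X]quadE val_lformP.
  by rewrite mulrDr mulrDl -scalerAr -scalerAl !linearP.
pose hL : {linear _ -> _} := HB.pack h (GRing.isLinear.Build _ _ _ _ h h_lin).
by rewrite (lfunE hL); apply/lfunP=> t; apply: E.
Qed.

(* nu (a /\ b) *)
Definition contr (nu : dual) (a b : U) : U := nu a *: b - nu b *: a.

Definition Bform (x y z w : U) (u : U) (nu : dual) : dual :=
  let pinv := ((pPhi x)^-1)%VF in
  - quad y (pinv (quad (contr nu z w) u))
  + quad z (pinv (quad (contr nu y w) u))
  - quad w (pinv (quad (contr nu y z) u)).

Lemma quadC u v : quad u v = quad v u.
Proof. by apply/lfunP=> t; rewrite [LHS]quadE [RHS]quadE [val (lform u) * _]mulrC. Qed.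

Lemma quadAC u v t : quad u v t = quad u t v.
Proof. by rewrite [LHS]quadE [RHS]quadE mulrAC. Qed.

Lemma quad_linear u : linear (quad u).
Proof.
move=> a v w; apply/lfunP=> t.
apply: etrans (esym (dualP a (quad u v) (quad u w) t)).
rewrite [LHS]quadE [X in _ = a * X + _]quadE [X in _ = _ + X]quadE val_lformP.
by rewrite mulrDr mulrDl -scalerAr -scalerAl !linearP.
Qed.
HB.instance Definition _ u :=
  GRing.isLinear.Build k U dual _ (quad u) (quad_linear u).

Lemma contr_linear a b : linear (fun nu => contr nu a b).
Proof.
move=> c f g; rewrite /contr !dualP scalerBr !scalerA !scalerDl.
by rewrite opprD addrACA.
Qed.

Let lin3 (V : lmodType k) (a : k) (A B C A' B' C' : V) :
  - (a *: A + A') + (a *: B + B') - (a *: C + C') =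
  a *: (- A + B - C) + (- A' + B' - C').
Proof.
by rewrite 2!scalerDr !scalerN !opprD [X in X + _ = _]addrACA [LHS]addrACA.
Qed.

Let qpq_linear x y v : linear (fun u => quad y ((pPhi x)^-1%VF (quad v u))).
Proof.
by move=> a u1 u2; rewrite (quad_linear v) (linearP (pPhi x)^-1%VF) (quad_linear y).
Qed.

Lemma Bform_linearl x y z w nu : linear (fun u => Bform x y z w u nu).
Proof.
move=> a u v; apply: etrans (lin3 _ _ _ _ _ _ _).
by rewrite /Bform; congr (- _ + _ - _); apply: qpq_linear.
Qed.

Lemma Bform_linearr x y z w u : linear (Bform x y z w u).
Proof.
move=> a f g; apply: etrans (lin3 _ _ _ _ _ _ _).
rewrite /Bform !contr_linear !(quadC (contr _ _ _) u) !(quadC (_ + _) u).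
by congr (- _ + _ - _); apply: qpq_linear.
Qed.

(* U_0^* as a subspace of U^* *)
Definition dual0 (x : U) : {vspace dual} :=
  lker (linfun (fun f : dual => f x : k^o)).

(* (i = 1, 2, 3): the elements y^*, z^*, w^* of U_0^* *)
Definition dcoord (x y z w : U) (i : 'I_4) : dual :=
  linfun (coord [tuple x; y; z; w] i : U -> k^o).

Variables (xs : dual) (x y z w : U).

Let U0 := lker xs.
Let U0s := dual0 x.

Definition tens0 (u : U) (nu : dual) : tensor (subvs_of U0) (subvs_of U0s) :=
  tens (vsproj U0 u) (vsproj U0s nu).

Definition evs : tensor (subvs_of U0) (subvs_of U0s) :=
  tens0 y (dcoord x y z w 1) + tens0 z (dcoord x y z w 2)
  + tens0 w (dcoord x y z w 3).

Definition calB_tens : 'Hom(tensor (subvs_of U0) (subvs_of U0s), subvs_of U0s) :=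
  tens_lift (fun (u : subvs_of U0) (nu : subvs_of U0s) =>
    vsproj U0s (Bform x y z w (vsval u) (vsval nu))).

(* (U_0 (x) U_0^* ) / ev^*(1) *)
Definition dom_calB : vectType k := quo <[evs]>%VS.

Definition calB : 'Hom(dom_calB, subvs_of U0s) :=
  quo_lift <[evs]>%VS calB_tens.

Lemma mem_dual0 f : (f \in dual0 x) = (f x == 0).
Proof.
rewrite memv_ker; set h := fun f : dual => _.
have h_lin : linear h by move=> a f1 f2; exact: dualP.
pose hL : {linear _ -> _} := HB.pack h (GRing.isLinear.Build _ _ _ _ h h_lin).
by rewrite (lfunE hL).
Qed.

Lemma Bform_dual0 u nu :
  (lker (pPhi x) == 0)%VS -> Bform x y z w u nu \in dual0 x.
Proof.
move=> p_inj.
have p_surj : limg (pPhi x) = fullv.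
  apply/eqP; rewrite eqEdim subvf limg_dim_eq; last by rewrite (eqP p_inj) capv0.
  by rewrite !dimvf /dim /= muln1.
have E a f : quad a ((pPhi x)^-1%VF f) x = f a.
  by rewrite quadC quadAC quadC -pPhiE limg_lfunVK ?p_surj ?memvf.
have P (p q s t : k) : - p * s + (q * t + 0) = q * t - p * s.
  by rewrite addr0 mulNr addrC.
have F a b c : quad (contr nu a b) u c =
    nu a * quad b u c - nu b * quad a u c.
  rewrite !(quadC _ u) /contr addrC -scaleNr quad_linear dualP.
  rewrite -[nu a *: b]addr0 quad_linear dualP linear0.
  have -> : (0 : dual) c = 0 by rewrite lfunE.
  by apply: P.
have D (f g h : dual) : (- f + g - h) x = - f x + g x - h x.
  by rewrite !lfunE /= !lfunE /= !lfunE.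
have S a b : quad a u b = quad b u a.
  by rewrite (quadC a u); apply: etrans (quadAC u a b) _; rewrite quadC.
have A (p q r a b c a' b' c' : k) : a = a' -> b = b' -> c = c' ->
    - (q * a - r * b) + (p * c - r * b') - (p * c' - q * a') = 0.
  by move=> -> -> ->; ring.
rewrite mem_dual0; apply/eqP; apply: etrans (D _ _ _) _.
apply: etrans (_ : - (quad (contr nu z w) u y) + quad (contr nu y w) u z
                   - quad (contr nu y z) u w = 0).
  by congr (- _ + _ - _); apply: E.
apply: etrans (_ : - (nu z * quad w u y - nu w * quad z u y) +
    (nu y * quad w u z - nu w * quad y u z) -
    (nu y * quad z u w - nu z * quad y u w) = 0).
  by congr (- _ + _ - _); apply: F.
by apply: A; apply: S.
Qed.

Lemma calB_tensE u nu : u \in U0 -> nu \in U0s ->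
  calB_tens (tens0 u nu) = vsproj U0s (Bform x y z w u nu).
Proof.
move=> uU0 nuU0s; rewrite /calB_tens /tens0 tens_liftE.
- by rewrite !vsprojK.
- move=> f a u1 u2; rewrite -linearP; congr (vsproj _ _).
  by rewrite -Bform_linearl linearP.
- move=> v a f g; rewrite -linearP; congr (vsproj _ _).
  by rewrite -Bform_linearr linearP.
Qed.

Hypotheses (xs_x : xs x = 1) (yzw : basis_of U0 [tuple y; z; w]).

Let yzw_U0 t : t \in [:: y; z; w] -> t \in U0.
Proof. exact: (basis_mem yzw). Qed.

Let xyzw_free : free [tuple x; y; z; w].
Proof.
rewrite /= free_cons (basis_free yzw) andbT (span_basis yzw) memv_ker xs_x.
exact: oner_neq0.
Qed.

Lemma dcoordE (i j : 'I_4) :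
  dcoord x y z w i [tuple x; y; z; w]`_j = (j == i)%:R.
Proof. by rewrite lfunE /= coord_free // eq_sym. Qed.

Lemma dcoord_dual0 (i : 'I_4) : i != 0 -> dcoord x y z w i \in U0s.
Proof.
by move=> i0; rewrite mem_dual0 (dcoordE i 0) [0 == i]eq_sym (negPf i0).
Qed.

(* calB_tens kills ev^*(1), so calB is well defined on the quotient *)
Lemma calB_tens_evs : calB_tens evs = 0.
Proof.
have yU : y \in U0 by apply: yzw_U0; rewrite !inE eqxx.
have zU : z \in U0 by apply: yzw_U0; rewrite !inE eqxx orbT.
have wU : w \in U0 by apply: yzw_U0; rewrite !inE eqxx !orbT.
have BD a b : calB_tens (a + b) = calB_tens a + calB_tens b by exact: linearD.
rewrite /evs !BD !calB_tensE ?dcoord_dual0 // -!linearD.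
suff -> : Bform x y z w y (dcoord x y z w 1) + Bform x y z w z (dcoord x y z w 2)
    + Bform x y z w w (dcoord x y z w 3) = 0 by rewrite linear0.
pose G a b c := quad a ((pPhi x)^-1%VF (quad b c)).
have G0 a c : G a 0 c = 0 by rewrite /G (quadC 0) !linear0.
have GN a b c : G a (- b) c = - G a b c.
  by rewrite /G (quadC (- b)) (quadC b) !linearN.
have e1 (i : 'I_4) : dcoord x y z w i y = (1 == i)%:R := dcoordE i 1.
have e2 (i : 'I_4) : dcoord x y z w i z = (2 == i)%:R := dcoordE i 2.
have e3 (i : 'I_4) : dcoord x y z w i w = (3 == i)%:R := dcoordE i 3.
have H1 : Bform x y z w y (dcoord x y z w 1) = G z w y - G w z y.
  rewrite /Bform /contr !e1 !e2 !e3 /= !scale1r !scale0r oppr0 !addr0.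
  apply: etrans (_ : - G y 0 y + G z w y - G w z y = _); first reflexivity.
  by clearbody G; rewrite G0 oppr0 add0r.
have H2 : Bform x y z w z (dcoord x y z w 2) = - G y w z + G w y z.
  rewrite /Bform /contr !e1 !e2 !e3 /= !scale1r !scale0r oppr0 !sub0r !addr0.
  apply: etrans (_ : - G y w z + G z 0 z - G w (- y) z = _); first reflexivity.
  by clearbody G; rewrite G0 GN opprK addr0.
have H3 : Bform x y z w w (dcoord x y z w 3) = G y z w - G z y w.
  rewrite /Bform /contr !e1 !e2 !e3 /= !scale1r !scale0r oppr0 !sub0r !addr0.
  apply: etrans (_ : - G y (- z) w + G z (- y) w - G w 0 w = _); first reflexivity.
  by clearbody G; rewrite G0 !GN opprK subr0.
rewrite H1 H2 H3.
have GC a b c : G a b c = G a c b by rewrite /G (quadC b).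
have add6 (V : zmodType) (A B C A' B' C' : V) : A = A' -> B = B' -> C = C' ->
    (A - B) + (- C + B') + (C' - A') = 0.
  move=> -> -> ->.
  by rewrite [- C' + B']addrC [A' - B' + _]addrA subrK addrA subrK subrr.
by clearbody G; apply: add6.
Qed.

Lemma calBE u nu : u \in U0 -> nu \in U0s -> (lker (pPhi x) == 0)%VS ->
  vsval (calB (quo_pi <[evs]>%VS (tens0 u nu))) = Bform x y z w u nu.
Proof.
move=> uU0 nuU0s p_inj; rewrite /calB quo_liftE.
  by rewrite calB_tensE // vsprojK ?Bform_dual0.
by rewrite -memvE memv_ker calB_tens_evs.
Qed.

End Macaulay.

Definition generates (R : comNzRingType) (I : R -> Prop) (s : seq R) : Prop :=
  forall f, I f <-> exists c : 'I_(size s) -> R, f = \sum_i c i * s`_i.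

(* For a homogeneous ideal this is the common size of the minimal homogeneous
   generating sets, by the graded Nakayama lemma. *)
Definition num_min_gens (R : comNzRingType) (I : R -> Prop) (n : nat) : Prop :=
  (exists s, generates I s /\ size s = n) /\
  (forall s, generates I s -> (n <= size s)%N).

(* Main.v *)
Require Import Defs.
From HB Require Import structures.
From mathcomp Require Import all_boot all_order all_algebra.
From mathcomp Require Import mpoly.

Set Implicit Arguments.
Unset Strict Implicit.
Unset Printing Implicit Defensive.

Import GRing.Theory.
Import passmx.

Local Open Scope ring_scope.

(* Since x is weak Lefschetz, <u, v> = Phi3(x u v) is a nondegenerate symmetric
   form on U, and a o b = p^-1((a b)(Phi3)) is a commutative, in general
   nonassociative, product with unit x and <a o b, c> = Phi3(a b c).  The
   degree 2 part of ann Phi3 is the kernel of Sym_2 U -> U, a b |-> a o b.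

   The subspace W of U spanned by the associators a o (b o u) - b o (a o u) is
   p^-1 of the image of calB, and a b c |-> a o (b o c) induces an isomorphism
   of Sym_3 U / (U . (ann Phi3)_2) with U / W.  Hence ann Phi3 needs 6 quadrics
   and 3 - dim W cubics, and nothing in higher degree.

   Finally dim W <> 1: the commutator of two multiplication operators is
   alternating for < , >, so its rank is even. *)

(** * Homogeneous components of polynomials and of their products *)

Section Homogeneous.
Variables (n : nat) (R : comNzRingType).
Implicit Types f g : {mpoly R[n]}.

Lemma dhomogS_split d f : f \is d.+1.-homog ->
  exists2 g : 'I_n -> {mpoly R[n]},
    forall i, g i \is d.-homog & f = \sum_i 'X_i * g i.
Proof.
(* Each monomial of f is charged to a single variable dividing it, so no term is counted twice.
   [ind] returns [None] only at the monomial 1, which cannot occur in degree [d.+1]. *)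
move=> fd; pose ind (m : 'X_{1..n}) := [pick i | m i != 0%N].
exists (fun i => \sum_(m <- msupp f | ind m == Some i) f@_m *: 'X_[m - U_(i)]).
  move=> i; rewrite big_seq_cond; apply: rpred_sum => m /andP[mf mi].
  apply: rpredZ; rewrite dhomogX /=.
  have := dhomog_mf fd mf; move: mi; rewrite /ind; case: pickP => //= j mj /eqP[<-].
  by rewrite -{1}(submK (m := U_(j)) (m' := m)) ?lep1mP // mdegD mdeg1 addn1 => -[->].
rewrite [LHS]mpolyE; under [RHS]eq_bigr do rewrite mulr_sumr big_mkcond.
rewrite exchange_big /= big_seq [RHS]big_seq; apply: eq_bigr => m mf.
have := dhomog_mf fd mf; rewrite /ind; case: pickP => [i mi _|m0 md].
  rewrite (bigD1 i) //= eqxx big1 ?addr0 => [|j ji].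
    by rewrite -scalerAr -mpolyXD addmC submK ?lep1mP.
  by rewrite (inj_eq Some_inj) eq_sym (negPf ji).
have: mdeg m = 0%N by rewrite mdegE big1 // => i _; apply/eqP/negbFE/m0.
by rewrite md.
Qed.

Lemma dhomog0_const f : f \is 0.-homog -> f = (f@_0%MM)%:MP.
Proof.
move=> /dhomogP f0; apply: msize1_polyC; rewrite msizeE.
apply/bigmax_leqP_seq => m mf _; by rewrite f0.
Qed.

Lemma pihomog_mul_dhomog b d f g : g \is b.-homog ->
  pihomog mdeg d (f * g) =
    if (b <= d)%N then pihomog mdeg (d - b) f * g else 0.
Proof.
(* The partition of f is made long enough to contain the index d - b even if f has lower degree. *)
move=> gb; pose K := maxn (msize f) d.+1.
have fK : (msize f <= K)%N by rewrite leq_maxl.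
rewrite {1}(pihomog_partitionE fK) mulr_suml linear_sum /=.
have E (a : 'I_K) : pihomog mdeg d (pihomog mdeg a f * g) =
    if (a + b == d)%N then pihomog mdeg a f * g else 0.
  have h : pihomog mdeg a f * g \is (a + b).-homog.
    by apply: dhomogM; rewrite ?pihomogP.
  by case: eqP => [<-|/eqP ab]; [apply: pihomog_dE|apply: pihomog_ne0 ab h].
under eq_bigr do rewrite E.
case: leqP => bd; last first.
  apply: big1 => a _; case: eqP => // ab.
  by move: bd; rewrite -ab ltnNge leq_addl.
have dK : (d - b < K)%N by rewrite leq_max ltnS leq_subr orbT.
rewrite (bigD1 (Ordinal dK)) //= subnK // eqxx big1 ?addr0 // => a.
rewrite -val_eqE /= => ad; case: eqP => // E'.
by rewrite -E' addnK eqxx in ad.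
Qed.

Lemma pihomogM d f g :
  pihomog mdeg d (f * g) =
    \sum_(b < d.+1) pihomog mdeg (d - b) f * pihomog mdeg b g.
Proof.
pose K := maxn (msize g) d.+1.
have gK : (msize g <= K)%N by rewrite leq_maxl.
rewrite {1}(pihomog_partitionE gK) mulr_sumr linear_sum /=.
rewrite (big_ord_widen K (fun b => pihomog mdeg (d - b) f * pihomog mdeg b g)).
  rewrite [RHS]big_mkcond; apply: eq_bigr => b _ /=.
  by rewrite (@pihomog_mul_dhomog b) ?pihomogP // ltnS.
by rewrite leq_maxr.
Qed.

End Homogeneous.

(** * Monomials of degree three and linear maps prescribed on them *)

Section Monomials3.
Variables (n : nat).

Lemma mnm1D_inj (i j a b : 'I_n) : (U_(i) + U_(j) = U_(a) + U_(b))%MM ->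
  (i = a /\ j = b) \/ (i = b /\ j = a).
Proof.
move=> E; have := congr1 (fun m : 'X_{1..n} => m a) E.
rewrite !mnmDE !mnm1E eqxx; case: (i =P a) E => [-> /addmI/eqP|_ E].
  by rewrite eq_mnm1 => /eqP ->; left.
case: (j =P a) E => // -> E _; right; split => //.
by move: E; rewrite [RHS]addmC => /addIm/eqP; rewrite eq_mnm1 => /eqP.
Qed.

(** Index triples with the same monomial differ by a permutation, and adjacent transpositions
    generate all permutations of three letters. [E] will be congruence modulo a subspace. *)
Lemma mnm1D3_symmetric (V : Type) (G : 'I_n -> 'I_n -> 'I_n -> V) (E : V -> V -> Prop) :
  (forall u, E u u) -> (forall u v w, E u v -> E v w -> E u w) ->
  (forall i j l, E (G i j l) (G j i l)) -> (forall i j l, E (G i j l) (G i l j)) ->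
  forall i j l a b c, (U_(i) + U_(j) + U_(l) = U_(a) + U_(b) + U_(c))%MM ->
  E (G i j l) (G a b c).
Proof.
move=> Er Et E12 E23 i j l a b c H.
have step i' j' l' b' c' : (U_(j') + U_(l') = U_(b') + U_(c'))%MM ->
    E (G i' j' l') (G i' b' c').
  by move/mnm1D_inj => [[-> ->]|[-> ->]].
have := congr1 (fun m : 'X_{1..n} => m i) H.
rewrite !mnmDE !mnm1E eqxx.
case: (a =P i) H => [-> H _|_].
  by apply: step; move: H; rewrite -!addmA => /addmI.
case: (b =P i) => [-> H _|_].
  apply: Et (E12 _ _ _); apply: step.
  by move: H; rewrite [in RHS](addmC U_(a)%MM) -!addmA => /addmI.
case: (c =P i) => // -> H _.
apply: (Et _ (G a i b)); last exact: E23.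
apply: Et (E12 _ _ _); apply: step.
by move: H; rewrite [RHS]addmC -!addmA => /addmI.
Qed.

(* G need not be symmetric: the value of T at a monomial is that of G at some
   ordering of its indices. *)
Lemma cubic_extension (k : fieldType) (V : vectType k) (G : 'I_n -> 'I_n -> 'I_n -> V) :
  exists2 T : {mpoly k[n]} -> V, linear T &
  forall a b c, exists i j l, (U_(i) + U_(j) + U_(l) = U_(a) + U_(b) + U_(c))%MM /\
     T ('X_a * 'X_b * 'X_c) = G i j l.
Proof.
(* The search succeeds only in degree 3 and [g] is 0 elsewhere, so summing over degrees below 4
   omits no nonzero value. *)
pose g (m : 'X_{1..n}) : V :=
  if [pick t : 'I_n * 'I_n * 'I_n | (U_(t.1.1) + U_(t.1.2) + U_(t.2) == m)%MM]
  is Some t then G t.1.1 t.1.2 t.2 else 0.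
exists (fun f : {mpoly k[n]} => \sum_(m : 'X_{1..n < 4}) f@_m *: g m).
  move=> u f h; rewrite scaler_sumr -big_split; apply: eq_bigr => m _ /=.
  by rewrite linearP scalerDl scalerA.
move=> a b c; rewrite -!mpolyXD; set m := (_ + _)%MM.
have m4 : (mdeg m < 4)%N by rewrite !mdegD !mdeg1.
rewrite (bigD1 (BMultinom m4)) //= mcoeffX eqxx scale1r big1 ?addr0; last first.
  by move=> m' mm'; rewrite mcoeffX eq_sym -[m]/(bmnm (BMultinom m4)) -bmeqP (negPf mm') scale0r.
rewrite /g; case: pickP => [[[i j] l] /= /eqP E|/(_ (a, b, c))]; last by rewrite eqxx.
by exists i, j, l.
Qed.

End Monomials3.

(** * Linear maps on bases, ranks of matrices, and commutators of multiplications *)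

Section LinearAlgebra.
Variable k : fieldType.

Lemma basis_linear_ind (V : vectType k) (X : seq V) (P : V -> Prop) :
  basis_of {:V} X -> P 0 -> (forall a u v, P u -> P v -> P (a *: u + v)) ->
  (forall u, u \in X -> P u) -> forall u, P u.
Proof.
move=> bX P0 Plin PX u; have := memvf u; rewrite -(span_basis bX) => /(coord_span (X := in_tuple X)) ->.
elim/big_ind: _ => // [v w Pv Pw|i _]; first by rewrite -[v]scale1r; apply: Plin.
by rewrite -[_ *: _]addr0; apply: Plin => //; apply/PX/mem_nth.
Qed.

Lemma linear_mem_basis (U V : vectType k) (X : seq U) (f : U -> V) (W : {vspace V}) :
  basis_of {:U} X -> linear f -> (forall u, u \in X -> f u \in W) ->
  forall u, f u \in W.
Proof.
move=> bX f_lin fX.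
have f0 : f 0 = 0 by move: (f_lin (-1) 0 0); rewrite scaler0 addr0 scaleN1r addNr.
apply: (basis_linear_ind bX) => // [|a u v fu fv]; first by rewrite f0 mem0v.
by rewrite f_lin memvD ?memvZ.
Qed.

Lemma linear_fun_sub (U V : lmodType k) (f g : U -> V) :
  linear f -> linear g -> linear (fun u => f u - g u).
Proof. by move=> fl gl a u v; rewrite fl gl scalerBr opprD addrACA. Qed.

Lemma linear_combB (U V : vectType k) (f : U -> V) p q u v :
  linear f -> f (p *: u - q *: v) = p *: f u - q *: f v.
Proof.
move=> fl; rewrite addrC -scaleNr fl scaleNr addrC; congr (_ - _).
have f0 : f 0 = 0 by move: (fl (-1) 0 0); rewrite scaler0 addr0 scaleN1r addNr.
by rewrite -[p *: u]addr0 fl f0 addr0.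
Qed.

Lemma linear_linfun (U V : vectType k) (f : U -> V) : linear f -> linfun f =1 f.
Proof.
move=> f_lin; pose fL : {linear U -> V} :=
  HB.pack f (GRing.isLinear.Build _ _ _ _ f f_lin).
exact: (lfunE fL).
Qed.

(** Evaluating a basis of W at v is a linear map from V to a space of smaller dimension, so it has a
    nonzero kernel. *)
Lemma dual_subspace_zero (V : vectType k) (W : {vspace 'Hom(V, k^o)}) :
  (\dim W < \dim {:V})%N -> exists2 v, v != 0 & forall f, f \in W -> f v = 0.
Proof.
move=> dW; pose b := vbasis W.
pose F (v : V) : 'rV[k]_(\dim W) := \row_i (b`_i : 'Hom(V, k^o)) v.
have F_lin : linear F by move=> a u v; apply/rowP=> i; rewrite !mxE linearP.
have Fv := linear_linfun F_lin.
have K0 : lker (linfun F) != 0%VS.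
  rewrite -dimv_eq0 -lt0n -(ltn_add2r (\dim W)) add0n (leq_trans dW) //.
  rewrite -(limg_ker_dim (linfun F)) capfv leq_add2l.
  by rewrite (leq_trans (dimvS (subvf _))) // dimvf /dim /= mul1n.
exists (vpick (lker (linfun F))); first by rewrite vpick0.
have := memv_pick (lker (linfun F)); rewrite memv_ker Fv => /eqP F0 f fW.
rewrite (coord_vbasis fW) sum_lfunE big1 // => i _; rewrite scale_lfunE.
by have := congr1 (fun r : 'rV[k]_(\dim W) => r 0 i) F0; rewrite !mxE => ->; rewrite scaler0.
Qed.

(** At most: f factors through its image, so the matrix is a product with inner size
    [\dim (limg f)]. At least: the vectors whose coordinates are the rows of a row base of the
    matrix span the image. *)
Lemma rank_mxof (U V : vectType k) (e : (\dim {:U}).-tuple U)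
    (e' : (\dim {:V}).-tuple V) (f : 'Hom(U, V)) :
  basis_of {:U} e -> basis_of {:V} e' -> \rank (mxof e e' f) = \dim (limg f).
Proof.
move=> be be'; set M := mxof e e' f; apply/eqP; rewrite eqn_leq; apply/andP; split.
  pose h : 'Hom(U, subvs_of (limg f)) := (linfun (vsproj (limg f)) \o f)%VF.
  pose g : 'Hom(subvs_of (limg f), V) := linfun vsval.
  have fE : f = (g \o h)%VF.
    by apply/lfunP=> u; rewrite !comp_lfunE !lfunE /= vsprojK ?memv_img ?memvf.
  have bL := vbasisP {:subvs_of (limg f)}.
  have dL : \dim {:subvs_of (limg f)} = \dim (limg f) by rewrite dimvf.
  rewrite -[leqRHS]dL /M [in leqLHS]fE (mxof_comp e e' bL).
  exact: leq_trans (mxrankM_maxl _ _) (rank_leq_col _).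
have -> : \rank M = size [seq vecof e' (row i (row_base M)) | i : 'I_(\rank M)].
  by rewrite size_map -cardE card_ord.
apply: leq_trans (dim_span _); apply: dimvS; apply/subvP=> _ /memv_imgP[u _ ->].
rewrite -[u](rVofK be) (hom_vecof e be') -/M.
have /submxP[D ->] : (rVof e u *m M <= row_base M)%MS.
  by rewrite (submx_trans (submxMl _ _)) // eq_row_base.
rewrite mulmx_sum_row linear_sum; apply: memv_suml => i _; rewrite linearZ memvZ //.
by apply/memv_span/image_f.
Qed.

Lemma tensor_span (V W : vectType k) (M : tensor V W) :
  M = \sum_i \sum_j M i j *: tens (vbasis {:V})`_i (vbasis {:W})`_j.
Proof.
rewrite {1}[M]matrix_sum_delta; apply: eq_bigr => i _; apply: eq_bigr => j _.
congr (_ *: _); rewrite /tens !rVofE ?vbasisP //.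
by rewrite trmx_delta mul_delta_mx.
Qed.

(* Commutators of multiplications are alternating for the invariant form, so
   their ranks are even. *)
Lemma associator_span_dim_neq1 (U : vectType k) (mul : U -> U -> U)
    (form : U -> U -> k) (W : {vspace U}) :
  (forall u v t, form (u - v) t = form u t - form v t) ->
  (forall a u t, form (a *: u) t = a * form u t) ->
  (forall u t, form u t = form t u) ->
  (forall a u t, form (mul a u) t = form u (mul a t)) ->
  (forall u, (forall t, form u t = 0) -> u = 0) ->
  (forall a b u, mul a (mul b u) - mul b (mul a u) \in W) ->
  ((forall a b u, mul a (mul b u) - mul b (mul a u) = 0) -> W = 0%VS) ->
  \dim W != 1%N.
Proof.
move=> formB formZ formC formM form0 asW as0; apply/eqP=> dW.
pose C a b u := mul a (mul b u) - mul b (mul a u).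
have CE a b u t : form (C a b u) t =
    form (mul b u) (mul a t) - form (mul a u) (mul b t).
  by rewrite /C formB (formM a (mul b u)) (formM b (mul a u)).
suff C0 a b u : C a b u = 0 by move: dW; rewrite as0 ?dimv0.
apply/eqP/negP=> /negP v0; have WE : W = <[C a b u]>%VS.
  by apply/esym/eqP; rewrite eqEdim -memvE asW dW dim_vline v0.
case/negP: v0; apply/eqP/form0 => t.
(* Skew symmetry turns the value into minus the pairing of [C a b t] with u. As W is a line,
   [C a b t] is a multiple of [C a b u], whose pairing with u vanishes by symmetry of the form, in
   every characteristic. *)
rewrite CE (formC (mul b u)) (formC (mul a u)) -opprB -CE.
have := asW a b t; rewrite WE -/(C a b t) => /vlineP[c ->]; rewrite formZ.
by rewrite CE formC subrr mulr0 oppr0.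
Qed.

End LinearAlgebra.

(** * The annihilator as a homogeneous ideal *)

Section Annihilator.
Variables (k : fieldType) (b : nat) (Phi : divpow k b).
Implicit Types f g : {mpoly k[4]}.

(** This ungraded test makes the ideal laws immediate. The component of degree a is tested by forms
    of degree b - a; conversely, the degree b part of f g is the sum of the products of components
    of complementary degrees. *)
Lemma annP f : ann Phi f <-> forall g, Phi (hcomp b (f * g)) = 0.
Proof.
split=> [f0 g|f0 a]; last first.
  apply/lfunP=> h; rewrite dactE lfunE.
  have hh : val h \is (b - a).-homog by exact: dhomog_is_dhomog.
  have [ab|ba] := leqP a b; last first.
    have ne : (a + (b - a))%N != b by rewrite neq_ltn (leq_trans ba) ?orbT ?leq_addr.
    by rewrite (hcomp_neq0 ne) ?linear0 // dhomogM ?pihomogP.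
  rewrite -[RHS](f0 (val h)); congr (Phi _); apply/val_inj => /=.
  rewrite (pihomog_mul_dhomog b f hh) leq_subr subKn //; apply: pihomog_dE.
  by have := dhomogM (pihomogP mdeg a f) hh; rewrite subnKC.
have -> : hcomp b (f * g) =
    \sum_(i < b.+1) hcomp b (val (hcomp (b - i) f) * val (hcomp i g)).
  apply/val_inj; rewrite /= pihomogM raddf_sum /=; apply: eq_bigr => i _.
  apply/esym/pihomog_dE; have ib : (i <= b)%N by rewrite -ltnS.
  by have := dhomogM (pihomogP mdeg (b - i) f) (pihomogP mdeg i g); rewrite subnK.
rewrite linear_sum big1 // => i _.
have ib : (i <= b)%N by rewrite -ltnS.
have hi : val (hcomp i g) \is (b - (b - i)).-homog by rewrite subKn // pihomogP.
have := congr1 (fun d : divpow k _ => d (DHomog hi)) (f0 (b - i)%N).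
by rewrite dactE lfunE.
Qed.

Lemma ann0 : ann Phi 0.
Proof. by apply/annP=> g; rewrite mul0r !linear0. Qed.

Lemma annD f g : ann Phi f -> ann Phi g -> ann Phi (f + g).
Proof.
by move=> /annP f0 /annP g0; apply/annP=> h; rewrite mulrDl linearD /= linearD /= f0 g0 addr0.
Qed.

Lemma annMl f g : ann Phi g -> ann Phi (f * g).
Proof. by move=> /annP g0; apply/annP=> h; rewrite [f * g]mulrC -mulrA. Qed.

Lemma ann_pihomog d f : ann Phi f -> ann Phi (pihomog mdeg d f).
Proof.
move=> f0; rewrite -[pihomog _ _ _]/(val (hcomp d f)).
by apply/anndP; rewrite mem_annd f0.
Qed.

End Annihilator.

Lemma dim_dhomog (k : fieldType) d : \dim {:dhomog 4 k d} = 'C(d + 3, d).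
Proof. by rewrite dimvf. Qed.

(** * Linear forms as elements of U *)

Section LinearForms.
Variables (k : fieldType) (U : vectType k) (e : 4.-tuple U).
Hypothesis he : basis_of {:U} e.

Lemma lform_basis (i : 'I_4) : val (lform e e`_i) = 'X_i.
Proof.
rewrite lformE (bigD1 i) //= coord_free ?(basis_free he) // eqxx scale1r.
by rewrite big1 ?addr0 // => j ji; rewrite coord_free ?(basis_free he) // eq_sym (negPf ji) scale0r.
Qed.

Lemma lform_inj : injective (lform e).
Proof.
move=> u v uv; rewrite (coord_basis he (memvf u)) (coord_basis he (memvf v)).
apply: eq_bigr => i _; congr (_ *: _).
have C t : (val (lform e t))@_U_(i) = coord e i t.
  rewrite lformE raddf_sum (bigD1 i) //= mcoeffZ mcoeffXU eqxx mulr1.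
  by rewrite big1 ?addr0 // => j ji; rewrite mcoeffZ mcoeffXU (negPf ji) mulr0.
by rewrite -!C uv.
Qed.

Lemma lform_surj (f : dhomog 4 k 1) : exists u, f = lform e u.
Proof.
have [g g0 fE] := dhomogS_split (dhomog_is_dhomog f).
exists (\sum_i (g i)@_0%MM *: e`_i); apply/val_inj; rewrite fE lformE.
apply: eq_bigr => i _; rewrite coord_sum_free ?(basis_free he) //.
by rewrite [in LHS](dhomog0_const (g0 i)) mulrC mul_mpolyC.
Qed.

End LinearForms.

Lemma dim_quo (k : fieldType) (V : vectType k) (W : {vspace V}) :
  \dim {:quo W} = (\dim {:V} - \dim W)%N.
Proof. by rewrite -dimv_compl dimvf. Qed.

(** * Nondegeneracy of p from the weak Lefschetz property *)

Section WeakLefschetz.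
Variables (k : fieldType) (U : vectType k) (e : 4.-tuple U) (Phi : divpow k 3).
Hypotheses (he : basis_of {:U} e)
  (hann : forall u : U, ann Phi (val (lform e u)) -> u = 0).

Lemma annd1_eq0 : annd Phi 1 = 0%VS.
Proof.
apply/eqP; rewrite -subv0; apply/subvP=> f /anndP f0; rewrite memv0.
by have [u fE] := lform_surj he f; move: f0; rewrite fE => /hann ->; rewrite linear0.
Qed.

(** Contraction with [Phi] maps the 10-dimensional Sym_2 U onto D_1 U^*, of dimension 4: a linear
    form killed by the whole image would annihilate [Phi]. The kernel has dimension 10 - 4. *)
Lemma dim_annd2 : \dim (annd Phi 2) = 6%N.
Proof.
pose F := linfun (fun f : dhomog 4 k 2 => dact f Phi).
have F_lin := linear_linfun (@dact_linear k 2 3 Phi).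
have dF : \dim (limg F) = 4%N.
  apply/eqP; rewrite eqn_leq; apply/andP; split.
    by rewrite (leq_trans (dimvS (subvf _))) // dimvf /dim /= muln1.
  rewrite leqNgt; apply/negP=> dF.
  have [|v v0 vF] := @dual_subspace_zero _ (dhomog 4 k 1) (limg F).
    by rewrite dim_dhomog.
  case/negP: v0; rewrite -memv0 -annd1_eq0 mem_annd; apply/eqP/lfunP=> h.
  rewrite dactE lfunE mulrC -[LHS](dactE h Phi v) -F_lin.
  exact/vF/memv_img/memvf.
by have := limg_ker_dim F fullv; rewrite capfv dF dim_dhomog => /(@addIn 4 _ 6).
Qed.

Lemma quad_eq0 u v : quad e Phi u v = 0 ->
  dact (hmul (lform e u) (lform e v)) Phi = 0.
Proof.
move=> q0; apply/lfunP=> f; have [t ->] := lform_surj he f.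
have := congr1 (fun d : dual U => d t) q0.
by rewrite /quad /divpow1 comp_lfunE !lfunE.
Qed.

(** The graded pieces of degrees 1 and 2 both have dimension 4, namely 4 - 0 and 10 - 6, so maximal
    rank means that multiplication by x between them is injective. If p(u) = 0 then x u vanishes in
    degree 2, hence u = 0. *)
Lemma pPhi_inj x : weak_lefschetz e Phi x -> lker (pPhi e Phi x) == 0%VS.
Proof.
move=> /(_ 1%N); rewrite !dim_quo !dim_dhomog annd1_eq0 dimv0 dim_annd2 => dA.
have A0 : lker (Amul e Phi x 1) == 0%VS.
  rewrite -dimv_eq0; have := limg_ker_dim (Amul e Phi x 1) fullv.
  by rewrite capfv dA dim_quo dim_dhomog annd1_eq0 dimv0 => /(@addIn 4 _ 0) ->.
apply/lker0P => u v uv; apply/eqP; rewrite -subr_eq0; apply/eqP.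
have {uv} : pPhi e Phi x (u - v) = 0 by rewrite linearB /= uv subrr.
rewrite pPhiE; move: (u - v) => {u v} u /quad_eq0 u0.
apply/(lform_inj he); rewrite linear0; apply/eqP.
have : lform e u \in annd Phi 1; last by rewrite annd1_eq0 memv0.
rewrite -[annd _ _]quo_pi_ker memv_ker -(inj_eq (lker0P A0)) linear0 AmulE.
by rewrite -memv_ker quo_pi_ker mem_annd u0.
Qed.

End WeakLefschetz.

(** * Induction on the degree through multiplication by linear forms *)

Section HomogeneousInduction.
Variables (k : fieldType) (U : vectType k) (e : 4.-tuple U).
Hypothesis he : basis_of {:U} e.

Lemma val_lmul u d (f : dhomog 4 k d) : val (lmul e u f) = val (lform e u) * val f.
Proof. exact: hmulE. Qed.

Lemma lmul_linearl d (f : dhomog 4 k d) : linear (fun u => lmul e u f).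
Proof.
move=> a u v; apply/val_inj.
by rewrite val_lmul val_lformP mulrDl -scalerAl -!val_lmul.
Qed.

Lemma lmul_linearr d u : linear (fun f : dhomog 4 k d => lmul e u f).
Proof. exact: linearP. Qed.

Lemma dhomogS_ind d (P : dhomog 4 k d.+1 -> Prop) :
  P 0 -> (forall f g, P f -> P g -> P (f + g)) ->
  (forall u (g : dhomog 4 k d), P (lmul e u g)) -> forall f, P f.
Proof.
move=> P0 PD PX f; have [g gd fE] := dhomogS_split (dhomog_is_dhomog f).
have -> : f = \sum_(i < 4) lmul e e`_i (DHomog (gd i)).
  apply/val_inj; rewrite fE raddf_sum; apply: eq_bigr => i _.
  by apply: etrans (esym (val_lmul _ _)); rewrite lform_basis.
by elim/big_ind: _.
Qed.

Lemma linear_mem_dhomogS d (V : vectType k) (W : {vspace V}) (phi : dhomog 4 k d.+1 -> V) :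
  linear phi -> (forall u g, phi (lmul e u g) \in W) -> forall f, phi f \in W.
Proof.
move=> phi_lin phiW.
have phiD f g : phi (f + g) = phi f + phi g.
  by rewrite -{1}[f]scale1r phi_lin scale1r.
apply: dhomogS_ind => // [|f g fW gW].
  suff -> : phi 0 = 0 by rewrite mem0v.
  by apply: (addrI (phi 0)); rewrite -phiD !addr0.
by rewrite phiD memvD.
Qed.

End HomogeneousInduction.

(** * The commutative product on U and its invariant form *)

Section InvariantProduct.
Variables (k : fieldType) (U : vectType k) (e : 4.-tuple U) (Phi : divpow k 3) (x : U).
Hypotheses (he : basis_of {:U} e) (p_inj : lker (pPhi e Phi x) == 0%VS).

Local Notation form := (quad e Phi x).

Definition mulU (a b : U) : U := (pPhi e Phi x)^-1%VF (quad e Phi a b).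

Lemma pPhiVK f : form ((pPhi e Phi x)^-1%VF f) = f.
Proof.
rewrite -pPhiE limg_lfunVK //.
suff -> : limg (pPhi e Phi x) = fullv by rewrite memvf.
apply/eqP; rewrite eqEdim subvf limg_dim_eq; last by rewrite (eqP p_inj) capv0.
by rewrite !dimvf /dim /= muln1.
Qed.

Lemma form_mulU a b : form (mulU a b) = quad e Phi a b.
Proof. exact: pPhiVK. Qed.

Lemma mulUC a b : mulU a b = mulU b a.
Proof. by rewrite /mulU quadC. Qed.

Lemma mulU_linear a : linear (mulU a).
Proof. by move=> c u v; rewrite /mulU quad_linear linearP. Qed.

Lemma mulU_linearl a : linear (mulU^~ a).
Proof. by move=> c u v; rewrite -!(mulUC a) mulU_linear. Qed.

Lemma mulU1 a : mulU x a = a.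
Proof. by rewrite /mulU -pPhiE lker0_lfunK. Qed.

Lemma formC a b : form a b = form b a.
Proof. exact: quadAC. Qed.

(** Both sides are the value of [Phi] at the cubic a u t. *)
Lemma form_mulUA a u t : form (mulU a u) t = form u (mulU a t).
Proof. by rewrite form_mulU [RHS]formC form_mulU quadAC. Qed.

Lemma form_nondeg u : (forall t, form u t = 0) -> u = 0.
Proof.
move=> u0; apply/eqP; rewrite -memv0 -(eqP p_inj) memv_ker pPhiE.
by apply/eqP/lfunP=> t; rewrite u0 lfunE.
Qed.

Lemma divpow1E (nu : divpow k 1) t : divpow1 e nu t = nu (lform e t).
Proof. by rewrite /divpow1 comp_lfunE lfunE. Qed.

Lemma divpow1_eq0 (nu : divpow k 1) : divpow1 e nu = 0 -> nu = 0.
Proof.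
move=> nu0; apply/lfunP=> f; have [t ->] := lform_surj he f.
by rewrite -divpow1E nu0 !lfunE.
Qed.

(** The linear extension of [mulU] to all quadrics; passing through p^-1 avoids choosing a
    decomposition of q into products. *)
Definition prod2 (q : dhomog 4 k 2) : U :=
  (pPhi e Phi x)^-1%VF (divpow1 e (dact q Phi)).

Lemma prod2_linear : linear prod2.
Proof.
move=> a f g; rewrite /prod2 -linearP; congr (_ _).
apply/lfunP=> t; apply: etrans (esym (dualP _ _ _ _)).
by rewrite !divpow1E dact_linear add_lfunE scale_lfunE.
Qed.

Lemma prod2E a b : prod2 (lmul e a (lform e b)) = mulU a b.
Proof. by []. Qed.

Lemma mem_annd2 q : (q \in annd Phi 2) = (prod2 q == 0).
Proof.
rewrite mem_annd; apply/eqP/eqP => [q0|].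
  by rewrite /prod2 q0 /divpow1 comp_lfun0l linear0.
move/(congr1 (quad e Phi x)); rewrite /prod2 pPhiVK linear0; exact: divpow1_eq0.
Qed.

End InvariantProduct.

(** * Cubics generated by the annihilating quadrics *)

Section QuadricMultiples.
Variables (k : fieldType) (U : vectType k) (e : 4.-tuple U) (Phi : divpow k 3) (x : U).
Hypotheses (he : basis_of {:U} e) (p_inj : lker (pPhi e Phi x) == 0%VS) (x0 : x != 0).

Local Notation mul := (mulU e Phi x).

(** U . (ann Phi)_2, the degree 3 part of the ideal generated by the quadrics of ann Phi. *)
Definition annd2_mul : {vspace dhomog 4 k 3} :=
  (\sum_(i < 4) (linfun (@lmul k U e e`_i 2) @: annd Phi 2))%VS.

Lemma mem_annd2_mul u q : q \in annd Phi 2 -> lmul e u q \in annd2_mul.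
Proof.
move=> q0; apply: (linear_mem_basis he (lmul_linearl e q)) => _ /tnthP[i ->].
apply: (subvP (sumv_sup i _ (subvv _))) => //.
by rewrite (tnth_nth 0) -(lfunE (@lmul k U e e`_i 2)) memv_img.
Qed.

Definition tri a b c : dhomog 4 k 3 := lmul e a (lmul e b (lform e c)).

Lemma val_tri a b c : val (tri a b c) = val (lform e a) * val (lform e b) * val (lform e c).
Proof. by rewrite !val_lmul mulrA. Qed.

Lemma triC12 a b c : tri a b c = tri b a c.
Proof. by apply/val_inj; rewrite !val_tri [val (lform e a) * _]mulrC. Qed.

(** Since x is the unit of the product, the quadric b c - x (b o c) has product 0 and so annihilates
    [Phi]. *)
Lemma tri_mul a b c : tri a b c - tri a x (mul b c) \in annd2_mul.
Proof.
rewrite -linearB; apply: mem_annd2_mul; rewrite (mem_annd2 he p_inj).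
rewrite [_ - _]addrC -scaleN1r prod2_linear !prod2E (mulU1 p_inj) scaleN1r.
by rewrite addNr.
Qed.

(** Two uses of [tri_mul], with a and x exchanged in between, reduce every product of three linear
    forms to x^2 times a linear form. *)
Lemma tri_xx a b c : tri a b c - tri x x (mul a (mul b c)) \in annd2_mul.
Proof.
have := memvD (tri_mul a b c) (tri_mul x a (mul b c)).
by rewrite (triC12 a x) addrA subrK.
Qed.

Lemma tri_xx_linear : linear (tri x x).
Proof. by move=> a u v; rewrite /tri !linearP. Qed.

Lemma tri_xxB u v : tri x x (u - v) = tri x x u - tri x x v.
Proof. by rewrite [u - v]addrC -scaleN1r tri_xx_linear scaleN1r addrC. Qed.

Lemma tri_xx_inj : lker (linfun (tri x x)) == 0%VS.
Proof.
rewrite -subv0; apply/subvP=> u; rewrite memv_ker memv0 (linear_linfun tri_xx_linear).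
move/eqP/(congr1 val); rewrite val_tri => /eqP; rewrite !mulf_eq0 orbb.
have L0 v : (val (lform e v) == 0) = (v == 0).
  by rewrite -(inj_eq (lform_inj he)) linear0 -(inj_eq val_inj).
by rewrite !L0 (negPf x0).
Qed.

Lemma annd2_mul_full : (limg (linfun (tri x x)) + annd2_mul = fullv)%VS.
Proof.
apply/eqP; rewrite eqEsubv subvf; apply/subvP=> f _.
apply: (linear_mem_dhomogS (phi := id) he) => [//|a q] /=.
apply: (linear_mem_dhomogS (phi := @lmul k U e a 2) he) => [|b l].
  exact: lmul_linearr.
have [c ->] := lform_surj he l.
rewrite -/(tri a b c) -[tri a b c](subrK (tri x x (mul a (mul b c)))) addrC.
by rewrite memv_add ?tri_xx // -(linear_linfun tri_xx_linear) memv_img ?memvf.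
Qed.

Variable W : {vspace U}.
Hypotheses (asW : forall a b u, mul a (mul b u) - mul b (mul a u) \in W)
  (Wmin : forall S : {vspace U},
    (forall a b u, mul a (mul b u) - mul b (mul a u) \in S) -> (W <= S)%VS).

(** Modulo W the expression a o (b o c) is symmetric, so it descends to a map from Sym_3 U to U / W.
    [T] is a lift of that map to U, fixed on monomials in the basis e. *)
Lemma cubic_product : exists2 T : dhomog 4 k 3 -> U, linear T &
  forall a b c, T (tri a b c) - mul a (mul b c) \in W.
Proof.
pose G (i j l : 'I_4) := mul e`_i (mul e`_j e`_l).
have [T0 T0_lin T0E] := cubic_extension G.
exists (fun f => T0 (val f)) => [a f g|]; first exact: T0_lin.
have base (i j l : 'I_4) : T0 (val (tri e`_i e`_j e`_l)) - G i j l \in W.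
  rewrite val_tri !lform_basis //; have [i' [j' [l' [E ->]]]] := T0E i j l.
  (* Exchanging the first two indices changes the value by an associator, which lies in W;
     exchanging the last two changes nothing, by commutativity. *)
  apply: (mnm1D3_symmetric (E := fun u v => u - v \in W)) E => [u|u v w uv vw|i1 j1 l1|i1 j1 l1].
  - by rewrite subrr mem0v.
  - by have := memvD uv vw; rewrite addrA subrK.
  - exact: asW.
  - by rewrite /G (mulUC e Phi x e`_j1) subrr mem0v.
have tlin (f : U -> dhomog 4 k 3) : linear f -> linear (fun u => T0 (val (f u))).
  by move=> fl a u v; rewrite fl; exact: T0_lin.
have mulUl := mulU_linearl e Phi x.
move=> a b c.
apply: (linear_mem_basis (f := fun a => T0 (val (tri a b c)) - mul a (mul b c)) he).
  apply: linear_fun_sub (mulUl _); apply: tlin; exact: lmul_linearl.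
move=> _ /tnthP[i ->]; rewrite (tnth_nth 0).
apply: (linear_mem_basis (f := fun b => T0 (val (tri e`_i b c)) - mul e`_i (mul b c)) he).
  apply: linear_fun_sub; last by move=> u v w; rewrite mulUl mulU_linear.
  by apply: tlin => u v w; rewrite /tri lmul_linearl linearP.
move=> _ /tnthP[j ->]; rewrite (tnth_nth 0).
apply: (linear_mem_basis (f := fun c => T0 (val (tri e`_i e`_j c)) - mul e`_i (mul e`_j c)) he).
  apply: linear_fun_sub; last by move=> u v w; rewrite !mulU_linear.
  by apply: tlin => u v w; rewrite /tri !linearP.
by move=> _ /tnthP[l ->]; rewrite (tnth_nth 0) base.
Qed.

(** By minimality of W, one inclusion need only be checked on associators: x^2 times an associator
    is the difference of two reductions of the same cubic a b u. For the other, [T] sends U . (ann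
    Phi)_2 into W, while T(x^2 u) is u modulo W. *)
Lemma cap_annd2_mul :
  (limg (linfun (tri x x)) :&: annd2_mul = linfun (tri x x) @: W)%VS.
Proof.
have RE := linear_linfun tri_xx_linear.
apply/eqP; rewrite eqEsubv; apply/andP; split; last first.
  rewrite subv_cap limgS ?subvf //=.
  apply: subv_trans (limgS _ (Wmin (S := linfun (tri x x) @^-1: annd2_mul) _)) _.
    move=> a b u; rewrite -memv_preim RE.
    have := memvB (tri_xx b a u) (tri_xx a b u).
    rewrite (triC12 b a) opprB addrC addrA subrK.
    by rewrite tri_xxB.
  by apply/subvP=> _ /memv_imgP[u uS ->]; rewrite -memv_preim in uS.
have [T T_lin TE] := cubic_product.
have Tmul a q : T (lmul e a q) - mul a (prod2 e Phi x q) \in W.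
  apply: (linear_mem_dhomogS (phi := fun q => T (lmul e a q) - mul a (prod2 e Phi x q)) he).
    apply: linear_fun_sub => c f g; first by rewrite lmul_linearr T_lin.
    by rewrite prod2_linear mulU_linear.
  by move=> b l; have [c ->] := lform_surj he l; rewrite prod2E TE.
have Tann f : f \in annd2_mul -> T f \in W.
  case/memv_sumP=> g gJ ->; have -> : T (\sum_i g i) = \sum_i T (g i).
    rewrite -(linear_linfun T_lin) linear_sum; apply: eq_bigr => i _.
    by rewrite -(linear_linfun T_lin).
  apply: memv_suml => i _; have /memv_imgP[q q0 ->] := gJ i isT.
  have := Tmul e`_i q; rewrite (lfunE (@lmul k U e e`_i 2)).
  move: q0; rewrite (mem_annd2 he p_inj) => /eqP ->.
  have -> : mul e`_i 0 = 0 by rewrite /mulU !linear0.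
  by rewrite subr0.
apply/subvP=> f; rewrite memv_cap => /andP[/memv_imgP[u _ ->]]; rewrite RE => /Tann.
have := TE x x u; rewrite !(mulU1 p_inj) => Tu uT; rewrite -RE memv_img //.
by have := memvB uT Tu; rewrite opprB addrC subrK.
Qed.

(** Sym_3 U has dimension 20 and x^2 U has dimension 4, so the dimension formula for sum and
    intersection reads 20 + dim W = 4 + dim [annd2_mul]. *)
Lemma dim_annd2_mul : \dim annd2_mul = (16 + \dim W)%N.
Proof.
have := dimv_sum_cap (limg (linfun (tri x x))) annd2_mul.
rewrite annd2_mul_full cap_annd2_mul !limg_dim_eq ?(eqP tri_xx_inj) ?capv0 //.
rewrite dim_dhomog (vector.size_basis he) => E.
by apply: (@addnI 4); rewrite -E addnA.
Qed.

End QuadricMultiples.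

(** * Ideals generated by finite sequences *)

Section IdealGeneration.
Variables (R : comNzRingType) (s : seq R).

Definition in_ideal (f : R) := exists c : 'I_(size s) -> R, f = \sum_i c i * s`_i.

Lemma in_ideal0 : in_ideal 0.
Proof. by exists (fun=> 0); rewrite big1 // => i _; rewrite mul0r. Qed.

Lemma in_idealD f g : in_ideal f -> in_ideal g -> in_ideal (f + g).
Proof.
move=> [c ->] [d ->]; exists (fun i => c i + d i).
by rewrite -big_split; apply: eq_bigr => i _; rewrite mulrDl.
Qed.

Lemma in_idealMl f g : in_ideal g -> in_ideal (f * g).
Proof.
move=> [c ->]; exists (fun i => f * c i).
by rewrite mulr_sumr; apply: eq_bigr => i _; rewrite mulrA.
Qed.

Lemma in_ideal_mem f : f \in s -> in_ideal f.
Proof.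
move=> fs; have fi : (index f s < size s)%N by rewrite index_mem.
exists (fun i => (i == Ordinal fi)%:R); rewrite (bigD1 (Ordinal fi)) //= eqxx mul1r.
by rewrite nth_index // big1 ?addr0 // => i /negPf ->; rewrite mul0r.
Qed.

Lemma in_ideal_sum (I : Type) (r : seq I) (P : pred I) F :
  (forall i, P i -> in_ideal (F i)) -> in_ideal (\sum_(i <- r | P i) F i).
Proof.
by move=> FP; elim/big_ind: _ => //; [exact: in_ideal0|exact: in_idealD].
Qed.

End IdealGeneration.

(** * The number of minimal generators of the annihilator *)

Section Generators.
Variables (k : fieldType) (U : vectType k) (e : 4.-tuple U) (Phi : divpow k 3) (x : U).
Hypotheses (he : basis_of {:U} e)
  (hann : forall u : U, ann Phi (val (lform e u)) -> u = 0)
  (p_inj : lker (pPhi e Phi x) == 0%VS) (x0 : x != 0).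

Lemma mem_annd3 (g : dhomog 4 k 3) : (g \in annd Phi 3) = (Phi g == 0).
Proof.
have gd := dhomog_is_dhomog g.
apply/idP/eqP=> [/anndP/annP/(_ 1)|g0]; rewrite ?mulr1.
  by congr (Phi _ = 0); apply/val_inj/hcompK.
(* As g already has degree 3, only the constant term of h reaches degree 3 in g h. *)
apply/anndP/annP=> h; have -> : hcomp 3 (val g * h) = (pihomog mdeg 0 h)@_0%MM *: g.
  apply/val_inj; rewrite /= mulrC (pihomog_mul_dhomog _ _ gd) /=.
  by rewrite [X in X * _](dhomog0_const (pihomogP mdeg 0 h)) mul_mpolyC.
by rewrite linearZ /= g0 scaler0.
Qed.

Lemma quad_tri a b c : quad e Phi a b c = Phi (tri e a b c).
Proof.
rewrite quadE -val_tri; congr (Phi _); apply/val_inj/hcompK; exact: dhomog_is_dhomog.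
Qed.

(** [Phi] is a nonzero functional on a space of dimension 20: otherwise x would be orthogonal to all
    of U, against nondegeneracy. *)
Lemma dim_annd3 : \dim (annd Phi 3) = 19%N.
Proof.
have -> : annd Phi 3 = lker Phi.
  by apply/vspaceP=> g; rewrite mem_annd3 memv_ker.
have := limg_ker_dim Phi fullv; rewrite capfv dim_dhomog.
suff -> : \dim (limg Phi) = 1%N by move=> /(@addIn 1 _ 19).
apply/eqP; rewrite eqn_leq; apply/andP; split.
  by rewrite (leq_trans (dimvS (subvf _))) // dimvf.
rewrite lt0n dimv_eq0; apply: contra x0; rewrite -lkerE => /subvP P0.
apply/eqP/(form_nondeg p_inj) => t; rewrite quad_tri.
by apply/eqP; rewrite -memv_ker P0 ?memvf.
Qed.

Lemma ann_pihomog1 f : ann Phi f -> pihomog mdeg 1 f = 0.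
Proof.
move/(ann_pihomog 1); rewrite -[pihomog _ _ _]/(val (hcomp 1 f)) => /anndP.
by rewrite (annd1_eq0 he hann) memv0 => /eqP ->.
Qed.

Lemma ann_pihomog0 f : ann Phi f -> pihomog mdeg 0 f = 0.
Proof.
move/(ann_pihomog 0); rewrite [pihomog _ _ _](dhomog0_const (pihomogP _ _ _)).
(* Multiplying the constant by x gives a linear form in the ideal, which must be 0. *)
move: (_@__) => c /(annMl (val (lform e x))).
have -> : val (lform e x) * c%:MP = val (lform e (c *: x)).
  by rewrite mulrC mul_mpolyC linearZ.
by move/hann/eqP; rewrite scaler_eq0 (negPf x0) orbF => /eqP ->; rewrite mpolyC0.
Qed.

(* ann Phi starts in degree 2, so modulo U . (ann Phi)_2 the components of degree
   2 and 3 of c s depend only on s and on the constant term of c. *)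
Lemma min_gens_lower s : generates (ann Phi) s ->
  (\dim (annd Phi 2) + \dim (annd Phi 3) <= size s + \dim (annd2_mul e Phi))%N.
Proof.
move=> sgen; have sI f : f \in s -> ann Phi f.
  by move=> fs; apply/sgen; exact: in_ideal_mem.
pose V : vectType k := (dhomog 4 k 2 * dhomog 4 k 3)%type.
pose inl2 (q : dhomog 4 k 2) : V := (q, 0).
pose inr3 (q : dhomog 4 k 3) : V := (0, q).
have inl2_lin : linear inl2.
  by move=> a u v; congr (_, _); rewrite /= scaler0 addr0.
have inr3_lin : linear inr3.
  by move=> a u v; congr (_, _); rewrite /= scaler0 addr0.
have inl2E := linear_linfun inl2_lin; have inr3E := linear_linfun inr3_lin.
have inl2_inj : lker (linfun inl2) == 0%VS.
  by apply/lker0P => u v; rewrite !inl2E => -[].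
have inr3_inj : lker (linfun inr3) == 0%VS.
  by apply/lker0P => u v; rewrite !inr3E => -[].
pose A := (linfun inl2 @: annd Phi 2)%VS; pose B := (linfun inr3 @: annd Phi 3)%VS.
have AB : (A :&: B = 0)%VS.
  apply/eqP; rewrite -subv0; apply/subvP=> v; rewrite memv_cap memv0.
  case/andP=> /memv_imgP[q _ ->] /memv_imgP[c _]; rewrite inl2E inr3E => -[-> _].
  by rewrite eqxx.
have <- : \dim A = \dim (annd Phi 2) by rewrite limg_dim_eq // (eqP inl2_inj) capv0.
have <- : \dim B = \dim (annd Phi 3) by rewrite limg_dim_eq // (eqP inr3_inj) capv0.
rewrite -dimv_disjoint_sum //.
pose p23 (f : {mpoly k[4]}) : V := (hcomp 2 f, hcomp 3 f).
have p23D f g : p23 (f + g) = p23 f + p23 g by rewrite /p23 !linearD.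
(* [E] has dimension at most the right-hand side of the bound, so it suffices that it contains the
   direct sum of (ann Phi)_2 and (ann Phi)_3. *)
pose E := (<<map p23 s>> + linfun inr3 @: annd2_mul e Phi)%VS.
have pE f : ann Phi f -> p23 f \in E.
  case/sgen => c ->; elim/big_ind: _ => [|u v uE vE|i _].
  - by rewrite /p23 !linear0 mem0v.
  - by rewrite p23D memvD.
  have si : ann Phi s`_i by apply/sI/mem_nth.
  (* A generator has no components in degrees 0 and 1, so the only term beyond the scalar multiple
     is the linear part of the coefficient times the quadratic part of the generator. *)
  have -> : p23 (c i * s`_i) = (pihomog mdeg 0 (c i))@_0%MM *: p23 s`_i +
      inr3 (hmul (hcomp 1 (c i)) (hcomp 2 s`_i)).
    have c0 g : pihomog mdeg 0 (c i) * g = (pihomog mdeg 0 (c i))@_0%MM *: g.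
      by rewrite [X in X * _](dhomog0_const (pihomogP _ _ _)) mul_mpolyC.
    have s0 := ann_pihomog0 si; have s1 := ann_pihomog1 si.
    congr (_, _); apply/val_inj; rewrite [LHS]pihomogM !big_ord_recr big_ord0 /=.
      by rewrite s0 s1 !mulr0 !add0r c0 addr0.
    rewrite s0 s1 !mulr0 !add0r c0 addrC; congr (_ + _).
    by apply/esym/pihomog_dE/(dhomogM (d := 1) (e := 2)); exact: pihomogP.
  apply: memv_add; first by rewrite memvZ // memv_span // map_f ?mem_nth.
  rewrite -inr3E memv_img //; have [u ->] := lform_surj he (hcomp 1 (c i)).
  by apply: mem_annd2_mul => //; apply/anndP/ann_pihomog.
have ABE : (A + B <= E)%VS.
  rewrite subv_add; apply/andP; split; apply/subvP=> _ /memv_imgP[q /anndP/pE qE ->];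
    have qd := dhomog_is_dhomog q.
    suff -> : linfun inl2 q = p23 (val q) by [].
    rewrite inl2E; congr (_, _); first exact/val_inj/esym/hcompK.
    by rewrite (hcomp_neq0 _ qd).
  suff -> : linfun inr3 q = p23 (val q) by [].
  rewrite inr3E; congr (_, _); last exact/val_inj/esym/hcompK.
  by rewrite (hcomp_neq0 _ qd).
apply: leq_trans (dimvS ABE) _; apply: leq_trans (dimv_add_leqif _ _) _.
rewrite leq_add //; first by rewrite -(size_map p23) dim_span.
by rewrite limg_dim_eq // (eqP inr3_inj) capv0.
Qed.

(* Modulo (ann Phi)_3, g is a multiple of h = x v t where (x v u)(Phi) = 0, and
   u h = t (x v u). *)
Lemma quartic_in_ideal (s : seq {mpoly k[4]}) :
  (forall f : dhomog 4 k 3, f \in annd Phi 3 -> in_ideal s (val f)) ->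
  forall f : dhomog 4 k 4, in_ideal s (val f).
Proof.
move=> s3; apply: (dhomogS_ind he) => [|f g sf sg|u g].
- exact: in_ideal0.
- exact: in_idealD.
(* This is one linear equation on the 4-dimensional space U. *)
have [v v0 vu] : exists2 v, v != 0 & quad e Phi x v u = 0.
  pose F := (pPhi e Phi x u : 'Hom(U, k^o)).
  have [|v v0 vF] := @dual_subspace_zero _ U <[F]>%VS.
    by rewrite (vector.size_basis he) dim_vline; case: (F != 0).
  exists v => //; rewrite formC -[RHS](vF F) ?memv_line //.
  by rewrite /F pPhiE.
have [t vt] : exists t, quad e Phi x v t != 0.
  have /lfunPn[t vt] : quad e Phi x v != 0.
    by apply: contra v0 => /eqP q0; apply/eqP/(form_nondeg p_inj) => t; rewrite q0 lfunE.
  have z : (0 : dual U) t = 0 by rewrite lfunE.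
  by exists t; rewrite z in vt.
(* The scaling makes [Phi h] equal to 1, so that [g - Phi g *: h] lies in (ann Phi)_3. *)
pose a := (quad e Phi x v t)^-1 *: t; pose h := tri e x v a.
have h1 : Phi h = 1 by rewrite -quad_tri linearZ; exact: mulVf.
have -> : val (lmul e u g) =
    val (lform e u) * val (g - Phi g *: h) + Phi g *: (val (lform e a) * val (tri e x v u)).
  have hE : val (lform e u) * val h = val (lform e a) * val (tri e x v u).
    by rewrite !val_tri [_ * val (lform e a)]mulrC mulrCA [val (lform e u) * _]mulrC.
  by rewrite val_lmul -hE scalerAr -mulrDr; congr (_ * _); rewrite -[LHS]/(val g) -[in LHS](subrK (Phi g *: h) g).
apply: in_idealD.
  apply/in_idealMl/s3; rewrite mem_annd3 linearB linearZ /= h1 subr_eq0 eq_sym.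
  by apply/eqP; exact: mulr1.
rewrite -mul_mpolyC; apply/in_idealMl/in_idealMl/s3.
by rewrite mem_annd3 -quad_tri vu.
Qed.

(** The generators are a basis of (ann Phi)_2 and a basis of a complement of U . (ann Phi)_2 in (ann
    Phi)_3. They generate every quartic by [quartic_in_ideal], hence everything of higher degree. *)
Lemma min_gens_upper : exists s, generates (ann Phi) s /\
  (size s + \dim (annd2_mul e Phi) = \dim (annd Phi 2) + \dim (annd Phi 3))%N.
Proof.
have J3 : (annd2_mul e Phi <= annd Phi 3)%VS.
  apply/subv_sumP => i _; apply/subvP=> _ /memv_imgP[q /anndP q0 ->].
  by rewrite (lfunE (@lmul k U e e`_i 2)); apply/anndP; rewrite val_lmul; exact: annMl.
pose C := (annd Phi 3 :\: annd2_mul e Phi)%VS.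
pose s := [seq val q | q <- vbasis (annd Phi 2)] ++ [seq val q | q <- vbasis C].
exists s; split; last first.
  rewrite size_cat !size_map !size_tuple -addnA; congr (_ + _)%N.
  by rewrite addnC -{1}(capv_idPr J3) dimv_cap_compl.
have s2 q : q \in annd Phi 2 -> in_ideal s (val q).
  move=> /coord_vbasis ->; rewrite raddf_sum; apply: in_ideal_sum => i _.
  rewrite /= -mul_mpolyC; apply/in_idealMl/in_ideal_mem; rewrite mem_cat.
  by apply/orP; left; apply/map_f/mem_nth; rewrite size_tuple.
have s3 q : q \in annd Phi 3 -> in_ideal s (val q).
  have -> : annd Phi 3 = (C + annd2_mul e Phi)%VS.
    by rewrite addv_diff; apply/esym/addv_idPl.
  case/memv_addP=> c cC [j jJ ->]; rewrite raddfD; apply: in_idealD.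
    rewrite (coord_vbasis cC) raddf_sum; apply: in_ideal_sum => i _.
    rewrite /= -mul_mpolyC; apply/in_idealMl/in_ideal_mem; rewrite mem_cat.
    by apply/orP; right; apply/map_f/mem_nth; rewrite size_tuple.
  case/memv_sumP: jJ => g gJ ->; rewrite raddf_sum; apply: in_ideal_sum => i _.
  have /memv_imgP[p pJ ->] := gJ i isT.
  rewrite (lfunE (@lmul k U e e`_i 2)).
  suff: in_ideal s (val (lmul e e`_i p)) by [].
  by rewrite val_lmul; apply/in_idealMl/s2.
have s4 d (f : dhomog 4 k (d + 4)) : in_ideal s (val f).
  elim: d f => [|d IHd]; first exact: quartic_in_ideal.
  apply: (dhomogS_ind he) => [|f g sf sg|u g].
  - exact: in_ideal0.
  - exact: in_idealD.
  by rewrite val_lmul; apply: in_idealMl.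
move=> f; split=> [f0|[c ->]].
  rewrite (pihomog_partitionE (leqnn (mmeasure mdeg f))); apply: in_ideal_sum => i _.
  have fi := ann_pihomog i f0.
  have [i4|] := leqP 4 i.
    have h : pihomog mdeg i f \is (i - 4 + 4).-homog by rewrite subnK ?pihomogP.
    exact: (s4 _ (DHomog h)).
  case: (nat_of_ord i) fi => [|[|[|[|//]]]] fi _.
  - by rewrite ann_pihomog0 //; exact: in_ideal0.
  - by rewrite ann_pihomog1 //; exact: in_ideal0.
  - by rewrite -[pihomog _ _ _]/(val (hcomp 2 f)); apply/s2/anndP.
  - by rewrite -[pihomog _ _ _]/(val (hcomp 3 f)); apply/s3/anndP.
elim/big_ind: _ => [|u v|i _]; [exact: ann0|exact: annD|apply: annMl].
have := mem_nth 0 (ltn_ord i); rewrite mem_cat => /orP[] /mapP[q qs ->];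
  apply/anndP; have := vbasis_mem qs => //.
exact: (subvP (diffvSl _ _)).
Qed.

Lemma num_min_gens_ann n :
  (n + \dim (annd2_mul e Phi) = \dim (annd Phi 2) + \dim (annd Phi 3))%N ->
  num_min_gens (ann Phi) n.
Proof.
move=> nE; split.
  by have [s [sgen sE]] := min_gens_upper; exists s; split=> //; apply: (@addIn (\dim (annd2_mul e Phi))); rewrite sE.
by move=> s /min_gens_lower; rewrite -nE leq_add2r.
Qed.

End Generators.

(** * Associators and the image of the map B *)

Section AssociatorImage.
Variables (k : fieldType) (U : vectType k) (e : 4.-tuple U) (Phi : divpow k 3)
  (xs : dual U) (x y z w : U).
Hypotheses (he : basis_of {:U} e) (p_inj : lker (pPhi e Phi x) == 0%VS)
  (hxs : xs x = 1) (hyzw : basis_of (lker xs) [tuple y; z; w]).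

Local Notation mul := (mulU e Phi x).
Local Notation pinv := ((pPhi e Phi x)^-1%VF).
Local Notation assoc a b u := (mul a (mul b u) - mul b (mul a u)).

Lemma xyzw_basis : basis_of {:U} [tuple x; y; z; w].
Proof.
rewrite basisEfree subvf (vector.size_basis he) andbT /= free_cons (basis_free hyzw).
by rewrite (span_basis hyzw) memv_ker hxs oner_neq0.
Qed.

(** Under p^-1 each term becomes a nested product a o (c o u), with c a contraction of [nu];
    collecting the coefficients of [nu y], [nu z] and [nu w] pairs the six products into
    associators. *)
Lemma pinv_Bform u (nu : dual U) :
  pinv (Bform e Phi x y z w u nu) =
  nu y *: assoc z w u - nu z *: assoc y w u + nu w *: assoc y z u.
Proof.
pose G a c := mul a (mul c u).
have G_lin a : linear (G a) by move=> c s t; rewrite /G mulU_linearl mulU_linear.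
have D (f g h : dual U) : pinv (- f + g - h) = - pinv f + pinv g - pinv h.
  by rewrite linearB linearD linearN.
apply: etrans (D _ _ _) _.
apply: (@etrans _ _ (- G y (contr nu z w) + G z (contr nu y w) - G w (contr nu y z))).
  by [].
rewrite /contr (linear_combB _ _ _ _ (G_lin y)) (linear_combB _ _ _ _ (G_lin z)).
rewrite (linear_combB _ _ _ _ (G_lin w)).
rewrite -[RHS]/(nu y *: (G z w - G w z) - nu z *: (G y w - G w y) + nu w *: (G y z - G z y)).
move: (G y z) (G y w) (G z y) (G z w) (G w y) (G w z) => yz yw zy zw wy wz.
(* The permutation brings together the two terms with the same coefficient, in the order [nu y],
   [nu z], [nu w]. *)
rewrite !scalerBr !opprB [LHS](AC (2*2*2) ((3*6)*(5*2)*(1*4))).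
by [].
Qed.

(** The subspace W of U. [mem_assoc_span] and [assoc_span_min] identify it as the span of all
    associators. *)
Definition assoc_span : {vspace U} :=
  (pinv @: (linfun vsval @: limg (calB e Phi xs x y z w)))%VS.

Lemma limg_calB : limg (calB e Phi xs x y z w) = limg (calB_tens e Phi xs x y z w).
Proof.
have K : (<[evs xs x y z w]> <= lker (calB_tens e Phi xs x y z w))%VS.
  by rewrite -memvE memv_ker calB_tens_evs.
apply/eqP; rewrite eqEsubv; apply/andP; split; apply/subvP=> _ /memv_imgP[t _ ->].
  rewrite -[t]quo_reprK quo_liftE // memv_img ?memvf //.
by rewrite -(quo_liftE _ K) memv_img ?memvf.
Qed.

Lemma dim_assoc_span : \dim assoc_span = \dim (limg (calB e Phi xs x y z w)).
Proof.
rewrite /assoc_span limg_dim_eq; last first.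
  apply/eqP; rewrite -subv0; apply/subvP=> f.
  rewrite memv_cap memv0 memv_ker => /andP[_ /eqP f0].
  by rewrite -(pPhiVK p_inj f) f0 linear0.
apply: limg_dim_eq; apply/eqP; rewrite -subv0; apply/subvP=> f.
rewrite memv_cap memv0 memv_ker => /andP[_ /eqP f0].
by apply/eqP/val_inj; rewrite lfunE in f0.
Qed.

Lemma pinv_Bform_span u nu : u \in lker xs -> nu \in dual0 x ->
  pinv (Bform e Phi x y z w u nu) \in assoc_span.
Proof.
move=> u0 nu0; rewrite memv_img // -(calBE hxs hyzw) //.
by rewrite -(lfunE vsval) !memv_img ?memvf.
Qed.

(** Tensors of basis vectors span the domain, and [pinv_Bform] sends each of them to a combination
    of associators. *)
Lemma assoc_span_min (S : {vspace U}) :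
  (forall a b u, assoc a b u \in S) -> (assoc_span <= S)%VS.
Proof.
move=> asS; apply/subvP=> _ /memv_imgP[_ /memv_imgP[t tB ->] ->].
move: tB; rewrite limg_calB => /memv_imgP[M _ ->].
rewrite [M]tensor_span !linear_sum; apply: memv_suml => i _.
rewrite !linear_sum; apply: memv_suml => j _; rewrite !linearZ memvZ //=.
set a := _`_i; set b := _`_j.
have -> : tens a b = tens0 xs x (vsval a) (vsval b) by rewrite /tens0 !vsvalK.
rewrite calB_tensE ?subvsP // lfunE /= vsprojK ?Bform_dual0 // pinv_Bform.
by rewrite memvD ?memvB ?memvZ.
Qed.

(** The associator is trilinear, alternating in a and b, and vanishes when any argument is the unit
    x. This leaves u in U_0 and the three pairs from y, z, w. *)
Lemma mem_assoc_span a b u : assoc a b u \in assoc_span.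
Proof.
pose A a b u := assoc a b u.
have AC a' b' u' : A b' a' u' = - A a' b' u' by rewrite /A opprB.
have yzwA u' : u' \in lker xs ->
    [/\ A z w u' \in assoc_span, A y w u' \in assoc_span & A y z u' \in assoc_span].
  (* Taking for [nu] the dual basis vectors y^*, z^*, w^* isolates the three associators one at a
     time. *)
  move=> u0; have H (i : 'I_4) : i != 0 -> (1 == i)%:R *: A z w u' -
      (2 == i)%:R *: A y w u' + (3 == i)%:R *: A y z u' \in assoc_span.
    move=> i0; have := pinv_Bform_span u0 (dcoord_dual0 hxs hyzw i0).
    rewrite pinv_Bform.
    have -> : dcoord x y z w i y = (1 == i)%:R := dcoordE hxs hyzw i 1.
    have -> : dcoord x y z w i z = (2 == i)%:R := dcoordE hxs hyzw i 2.
    by have -> : dcoord x y z w i w = (3 == i)%:R := dcoordE hxs hyzw i 3.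
  move: (A z w u') (A y w u') (A y z u') H => X Y Z H.
  split; [have := H 1 isT|have := H 2 isT|have := H 3 isT]; rewrite /= scale1r !scale0r.
  - by rewrite subr0 addr0.
  - by rewrite sub0r addr0 memvN.
  - by rewrite oppr0 !add0r.
have Ax b' u' : A x b' u' = 0 by rewrite /A !(mulU1 p_inj) subrr.
have Axr a' b' : A a' b' x = 0.
  by rewrite /A !(mulUC _ _ _ _ x) !(mulU1 p_inj) (mulUC _ _ _ a') subrr.
have U0 t : t \in [:: y; z; w] -> t \in lker xs := basis_mem hyzw (x := t).
apply: (linear_mem_basis (f := A a b) xyzw_basis) => [|u'].
  by apply: linear_fun_sub => c s t; rewrite !mulU_linear.
rewrite inE => /orP[/eqP ->|/U0/yzwA[Azw Ayw Ayz]]; first by rewrite Axr mem0v.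
apply: (linear_mem_basis (f := A ^~ b ^~ u') xyzw_basis) => [|a'].
  by apply: linear_fun_sub => c s t; rewrite !mulU_linearl ?mulU_linear.
rewrite inE => /orP[/eqP ->|a0]; first by rewrite Ax mem0v.
apply: (linear_mem_basis (f := A a' ^~ u') xyzw_basis) => [|b'].
  by apply: linear_fun_sub => c s t; rewrite !mulU_linearl ?mulU_linear.
rewrite inE => /orP[/eqP ->|b0]; first by rewrite AC Ax oppr0 mem0v.
have Aaa c : A c c u' = 0 by rewrite /A subrr.
move: a0 b0; rewrite !inE; clearbody A.
by move=> /or3P[] /eqP-> /or3P[] /eqP->; rewrite ?Aaa ?mem0v // AC memvN.
Qed.

End AssociatorImage.

(** * The dimension of the target and the three possible ranks *)

Lemma dim_dual0 (k : fieldType) (U : vectType k) (xs : dual U) (x : U) :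
  xs x = 1 -> \dim (dual0 x) = (\dim {:U}).-1.
Proof.
move=> hxs; pose ev (f : dual U) := f x : k^o.
have ev_lin : linear ev by move=> a f g; exact: dualP.
have := limg_ker_dim (linfun ev) fullv.
have -> : \dim {:dual U} = \dim {:U} by rewrite !dimvf /dim /= muln1.
rewrite capfv -/(dual0 x).
suff -> : \dim (limg (linfun ev)) = 1%N by rewrite addn1 => <-.
apply/eqP; rewrite eqn_leq; apply/andP; split.
  by rewrite (leq_trans (dimvS (subvf _))) // dimvf.
rewrite lt0n dimv_eq0 -lkerE; apply/negP=> /subvP/(_ xs (memvf _)).
by rewrite memv_ker (linear_linfun ev_lin) /ev hxs oner_eq0.
Qed.

Theorem theorem6p6 (k : fieldType) (U : vectType k) (hU : \dim {:U} = 4%N)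
    (e : 4.-tuple U) (he : basis_of {:U} e)
    (Phi3 : divpow k 3)
    (hann : forall u : U, ann Phi3 (val (lform e u)) -> u = 0)
    (x : U) (hx : weak_lefschetz e Phi3 x)
    (xs : dual U) (hxs : xs x = 1)
    (y z w : U) (hyzw : basis_of (lker xs) [tuple y; z; w])
    (bQ : (\dim {:dom_calB xs x y z w}).-tuple (dom_calB xs x y z w))
    (hbQ : basis_of {:dom_calB xs x y z w} bQ)
    (bD : (\dim {:subvs_of (dual0 x)}).-tuple (subvs_of (dual0 x)))
    (hbD : basis_of {:subvs_of (dual0 x)} bD) :
  let B := (mxof bQ bD (calB e Phi3 xs x y z w))^T in
  [\/ \rank B = 0%N /\ num_min_gens (ann Phi3) 9%N,
      \rank B = 2%N /\ num_min_gens (ann Phi3) 7%N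
    | \rank B = 3%N /\ num_min_gens (ann Phi3) 6%N].
Proof.
move=> B; have p_inj := pPhi_inj he hann hx.
have x0 : x != 0.
  by apply/eqP=> x0; move/eqP: hxs; rewrite x0 linear0 eq_sym oner_eq0.
pose W := assoc_span e Phi3 xs x y z w.
have asW := mem_assoc_span he p_inj hxs hyzw.
have Wmin := assoc_span_min p_inj hxs hyzw.
have rB : \rank B = \dim W.
  by rewrite mxrank_tr rank_mxof // /W dim_assoc_span.
(* W has the dimension of the image of [calB], which lies in the 3-dimensional space U_0^*. *)
have W3 : (\dim W <= 3)%N.
  rewrite /W dim_assoc_span // (leq_trans (dimvS (subvf _))) //.
  by rewrite dimvf /dim /= (dim_dual0 hxs) hU.
have W1 : \dim W != 1%N.
  apply: (associator_span_dim_neq1 (mul := mulU e Phi3 x) (form := quad e Phi3 x)) => //.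
  - by move=> u v t; rewrite linearB /= add_lfunE opp_lfunE.
  - by move=> a u t; rewrite linearZ /= scale_lfunE.
  - exact: formC.
  - exact: form_mulUA.
  - exact: form_nondeg.
  - move=> as0; apply/eqP; rewrite -subv0; apply: Wmin => a b u.
    by rewrite as0 mem0v.
have gens := num_min_gens_ann he hann p_inj x0.
have dJ := dim_annd2_mul he p_inj x0 asW Wmin.
(* The count becomes n + (16 + dim W) = 6 + 19, that is n = 9 - dim W. *)
rewrite (dim_annd2 he hann) (dim_annd3 p_inj x0) dJ in gens; rewrite rB.
case: (\dim W) W3 W1 gens => [|[|[|[|//]]]] // _ _ gens.
- by constructor 1; split=> //; apply: gens.
- by constructor 2; split=> //; apply: gens.
- by constructor 3; split=> //; apply: gens.
Qed.
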